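(* Let $n \ge 3$ be an integer and let $\Im$ be a strongly balanced edge-to-edge tiling of the plane all of whose tiles are convex $n$-gons. Then $$\sum_{j \ge 3} j \cdot w_j(\Im) = \frac{2n}{n-2}.$$
   Context: A tiling is a collection of closed sets (tiles) covering the plane with pairwise disjoint interiors. A convex $n$-gon is a convex polygon with exactly $n$ sides and $n$ corners (all interior angles less than $180^\circ$); the tiles of a tiling by convex $n$-gons need not be congruent. A tiling by convex polygons is edge-to-edge if any two distinct tiles are either disjoint or share exactly one corner or one entire side in common; equivalently, the corners and sides of the polygons coincide with the vertices and edges of the tiling. A vertex of the tiling is a point belonging to at least three tiles, and its valence is the number of tiles meeting there (so valences are at least three). The vertices divide the boundaries of the tiles into arcs, called the edges of the tiling. Two distinct tiles are adjacent if they have an edge of the tiling in common; the adjacents of a tile are the tiles adjacent to it. A tiling is normal if (i) every tile is a topological disk; (ii) the intersection of every two tiles is a connected set; (iii) the tiles are uniformly bounded: there are $u,U>0$ such that every tile contains some disk of radius $u$ and is contained in some disk of radius $U$. For $r>0$ and an arbitrary point $M$ of the plane, let $D(r,M)$ be the closed disk of radius $r$ centered at $M$. Let $F_1$ be the set of tiles contained in $D(r,M)$, $F_2$ the set of tiles meeting the boundary of $D(r,M)$ but not contained in $D(r,M)$, and $F_3$ the set of tiles surrounded by the tiles of $F_2$ but not belonging to $F_2$. The patch $A(r,M)$ is $F_1\cup F_2\cup F_3$. Let $t(r,M)$ and $v(r,M)$ be the numbers of tiles and vertices in $A(r,M)$, $t_h(r,M)$ the number of tiles in $A(r,M)$ with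 exactly $h$ adjacents, and $v_j(r,M)$ the number of $j$-valent vertices in $A(r,M)$. A tiling $\Im$ is strongly balanced if it is normal and all the limits $t_h(\Im)=\lim_{r\to\infty} t_h(r,M)/t(r,M)$ and $v_j(\Im)=\lim_{r\to\infty} v_j(r,M)/t(r,M)$ exist. Then $v(\Im)=\lim_{r\to\infty} v(r,M)/t(r,M)$ exists, equals $\sum_{j\ge 3}v_j(\Im)$, and one sets $w_j(\Im)=v_j(\Im)/v(\Im)$. *)

(* Defs.v *)
(* The plane is R * R, with the Euclidean distance edist
   for disks (the library norm on R * R is the max norm, which induces the
   same topology). *)
From HB Require Import structures.
From mathcomp Require Export all_boot all_order all_algebra.
From mathcomp Require Export finmap.
From mathcomp Require Export all_classical all_reals.
From mathcomp Require Export topology normedtype sequences.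
Export Order.TTheory GRing.Theory Num.Theory numFieldNormedType.Exports.

Set Implicit Arguments.
Unset Strict Implicit.
Unset Printing Implicit Defensive.

Local Open Scope classical_set_scope.
Local Open Scope ring_scope.

Notation plane R := (R * R)%type.

Definition edist (R : realType) (x y : plane R) : R :=
  Num.sqrt ((x.1 - y.1) ^+ 2 + (x.2 - y.2) ^+ 2).

Definition disk (R : realType) (r : R) (M : plane R) : set (plane R) :=
  [set x | edist x M <= r].

Definition circle (R : realType) (r : R) (M : plane R) : set (plane R) :=
  [set x | edist x M = r].

Definition segment (R : realType) (a b : plane R) : set (plane R) :=
  [set x | exists t : R, [/\ 0 <= t, t <= 1 &
     x = ((1 - t) * a.1 + t * b.1, (1 - t) * a.2 + t * b.2)]].

Definition hull (R : realType) (n : nat) (p : 'I_n -> plane R) :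
    set (plane R) :=
  [set x | exists l : 'I_n -> R, [/\ forall i, 0 <= l i, \sum_i l i = 1 &
     x = (\sum_i l i * (p i).1, \sum_i l i * (p i).2)]].

(* Twice the signed area of the triangle abc: positive iff c lies strictly to
   the left of the line directed from a to b. *)
Definition orient (R : realType) (a b c : plane R) : R :=
  (b.1 - a.1) * (c.2 - a.2) - (b.2 - a.2) * (c.1 - a.1).

(* p lists the n corners of the convex polygon P counterclockwise, the sides
   being the segments [p i, p (i + 1 mod n)] (ordS is the cyclic successor).
   All the corners other than its two ends lie strictly to the left of each
   side; in particular the corners are distinct and all the interior angles
   are less than pi.  Meaningful for 3 <= n only. *)
Definition corners_of (R : realType) (n : nat) (P : set (plane R))
    (p : 'I_n -> plane R) : Prop :=
  (forall i k : 'I_n, k != i -> k != ordS i ->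
     0 < orient (p i) (p (ordS i)) (p k)) /\
  P = hull p.

Definition convex_ngon (R : realType) (n : nat) (P : set (plane R)) : Prop :=
  exists p : 'I_n -> plane R, corners_of P p.

(* The corner list is unique up to a cyclic shift, so the next two notions
   depend only on the polygon P. *)
Definition is_corner (R : realType) (n : nat) (P : set (plane R))
    (x : plane R) : Prop :=
  exists p : 'I_n -> plane R, corners_of P p /\ exists i, x = p i.

Definition is_side (R : realType) (n : nat) (P S : set (plane R)) : Prop :=
  exists p : 'I_n -> plane R,
    corners_of P p /\ exists i, S = segment (p i) (p (ordS i)).

(* A tiling is given by its set of tiles. *)
Definition tiling (R : realType) (T : set (set (plane R))) : Prop :=
  [/\ forall A, T A -> closed A,
      \bigcup_(A in T) A = setT &
      forall A B, T A -> T B -> A <> B -> interior A `&` interior B = set0].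

Definition edge_to_edge (R : realType) (n : nat) (T : set (set (plane R))) :
    Prop :=
  forall A B, T A -> T B -> A <> B ->
    [\/ A `&` B = set0,
        exists x, [/\ is_corner n A x, is_corner n B x & A `&` B = [set x]] |
        exists S, [/\ is_side n A S, is_side n B S & A `&` B = S]].

Definition topological_disk (R : realType) (A : set (plane R)) : Prop :=
  exists f g : plane R -> plane R,
    [/\ {within disk 1 (0, 0), continuous f}, {within A, continuous g},
        f @` disk 1 (0, 0) = A, g @` A = disk 1 (0, 0) &
        {in disk 1 (0, 0), cancel f g} /\ {in A, cancel g f}].

Definition normal_tiling (R : realType) (T : set (set (plane R))) : Prop :=
  [/\ tiling T,
      forall A, T A -> topological_disk A,
      forall A B, T A -> T B -> A <> B -> connected (A `&` B) &
      exists u U : R, [/\ 0 < u, 0 < U & forall A, T A ->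
        (exists c, disk u c `<=` A) /\ (exists c, A `<=` disk U c)]].

Definition tiles_at (R : realType) (T : set (set (plane R))) (x : plane R) :
    set (set (plane R)) :=
  [set A | T A /\ A x].

Definition vertex (R : realType) (T : set (set (plane R))) (x : plane R) :
    Prop :=
  (`I_3 #<= tiles_at T x)%card.

Definition has_valence (R : realType) (T : set (set (plane R))) (j : nat)
    (x : plane R) : Prop :=
  (tiles_at T x #= `I_j)%card.

Definition boundary (R : realType) (A : set (plane R)) : set (plane R) :=
  closure A `\` interior A.

(* The edges of the tiling on the boundary of the tile A: the closed arcs into
   which the vertices of the tiling divide that boundary. *)
Definition tile_edge (R : realType) (T : set (set (plane R)))
    (A e : set (plane R)) : Prop :=
  exists x, (boundary A `\` vertex T) x /\
    e = closure (connected_component (boundary A `\` vertex T) x).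

Definition adjacents (R : realType) (T : set (set (plane R)))
    (A : set (plane R)) : set (set (plane R)) :=
  [set B | [/\ T B, A <> B & exists e, tile_edge T A e /\ tile_edge T B e]].

Definition F1 (R : realType) (T : set (set (plane R))) (r : R) (M : plane R) :
    set (set (plane R)) :=
  [set A | T A /\ A `<=` disk r M].

Definition F2 (R : realType) (T : set (set (plane R))) (r : R) (M : plane R) :
    set (set (plane R)) :=
  [set A | [/\ T A, A `&` circle r M !=set0 & ~ (A `<=` disk r M)]].

(* A is surrounded by the tiles of S: away from their union, which it may touch
   along its boundary, A lies in bounded components of the complement of that
   union. *)
Definition surrounded (R : realType) (S : set (set (plane R)))
    (A : set (plane R)) : Prop :=
  let C := ~` (\bigcup_(B in S) B) in
  forall x, (A `&` C) x -> bounded_set (connected_component C x).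

Definition F3 (R : realType) (T : set (set (plane R))) (r : R) (M : plane R) :
    set (set (plane R)) :=
  [set A | [/\ T A, ~ F2 T r M A & surrounded (F2 T r M) A]].

Definition patch (R : realType) (T : set (set (plane R))) (r : R)
    (M : plane R) : set (set (plane R)) :=
  F1 T r M `|` F2 T r M `|` F3 T r M.

Definition patch_vertices (R : realType) (T : set (set (plane R))) (r : R)
    (M : plane R) : set (plane R) :=
  [set x | vertex T x /\ exists2 A, patch T r M A & A x].

(* The number of elements of a finite set (0 for an infinite set; only finite
   sets are counted below when the tiling is normal), as a real number. *)
Definition count_set (R : realType) (K : choiceType) (A : set K) : R :=
  (#|` fset_set A |)%:R.

Definition t_num (R : realType) (T : set (set (plane R))) (r : R)
    (M : plane R) : R :=
  count_set R (patch T r M).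

Definition v_num (R : realType) (T : set (set (plane R))) (r : R)
    (M : plane R) : R :=
  count_set R (patch_vertices T r M).

Definition th_num (R : realType) (T : set (set (plane R))) (h : nat) (r : R)
    (M : plane R) : R :=
  count_set R [set A | patch T r M A /\ (adjacents T A #= `I_h)%card].

Definition vj_num (R : realType) (T : set (set (plane R))) (j : nat) (r : R)
    (M : plane R) : R :=
  count_set R [set x | patch_vertices T r M x /\ has_valence T j x].

(* The point M is kept as an explicit parameter: the limits are only required
   to exist for the disks centered at M, and the quantities below are defined
   with that same M. *)
Definition strongly_balanced (R : realType) (T : set (set (plane R)))
    (M : plane R) : Prop :=
  [/\ normal_tiling T,
      forall h : nat, cvg (th_num T h r M / t_num T r M @[r --> +oo]) &
      forall j : nat, cvg (vj_num T j r M / t_num T r M @[r --> +oo])].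

Definition v_lim (R : realType) (T : set (set (plane R))) (M : plane R) : R :=
  lim (v_num T r M / t_num T r M @[r --> +oo]).

Definition vj_lim (R : realType) (T : set (set (plane R))) (M : plane R)
    (j : nat) : R :=
  lim (vj_num T j r M / t_num T r M @[r --> +oo]).

Definition w_lim (R : realType) (T : set (set (plane R))) (M : plane R)
    (j : nat) : R :=
  vj_lim T M j / v_lim T M.

(* Main.v *)
Require Import Defs.
From mathcomp Require Import ring lra zify.
Set Implicit Arguments.
Unset Strict Implicit.
Unset Printing Implicit Defensive.
Local Open Scope classical_set_scope.
Local Open Scope ring_scope.

(** The mean valence of the vertices is the limit of the ratio between the number
of pairs (tile, corner of that tile) and the number of vertices of a patch.
Every tile contributes n such pairs, because in an edge-to-edge tiling the
vertices on a tile are exactly its corners ([vertex_corner],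
[corner_vertex]).  It remains to see that there are (n - 2) / 2 vertices per
tile.

The classical argument compares the angle sum (n - 2) pi of a tile with the full
angle 2 pi around a vertex.  Angles are replaced here by a single direction d,
chosen parallel to no side of the finitely many tiles concerned.  Around a
vertex exactly one tile has d pointing into its interior
([exists_entered], [enters_unique]), and exactly one has the opposite
direction pointing inside.  At a corner of a convex polygon, d or its opposite
points inside unless the corner is the highest or the lowest one for the linear
form [cross _ d]; hence this happens at n - 2 corners of every n-gon
([enter_count]).  Counting twice, there are n - 2 such incidences per tile and 2
per vertex.

Both counts are inexact near the boundary of a patch.  Let N(r) be the number of
tiles inside the disk of radius r about M and let t(r) be the number of tiles of
the patch, whose tiles all lie inside the disk of radius r + 2U
([patch_inside]).  A count with weight w per tile gives a sum over the vertices
of the patch that lies between w t(r) and w N(r + 4U) ([double_count]), while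
N(r) <= t(r).  Each tile contains a disk of radius u, so N grows at most
quadratically ([card_inside]) and therefore cannot be multiplied by a
factor 1 + e at each step r, r + 4U, r + 8U, ...  Thus N(r + 4U) / N(r) is
below 1 + e for arbitrarily large r.  As the limits of the ratios exist by
hypothesis, this is enough to identify them ([limit_of_sandwich]).  Finally the
valences are bounded, so the series of the statement is a finite sum. *)

(** * Plane vectors and Euclidean distance *)

Section Plane.
Variable R : realType.
Implicit Types (a b c x y d : plane R) (s t : R).

Definition cross (u v : plane R) : R := u.1 * v.2 - u.2 * v.1.
Definition vec a b : plane R := (b.1 - a.1, b.2 - a.2).
Definition opp d : plane R := (- d.1, - d.2).
Definition along x s d : plane R := (x.1 + s * d.1, x.2 + s * d.2).

Lemma orient_along a b x s d :
  orient a b (along x s d) = orient a b x + s * cross (vec a b) d.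
Proof. rewrite /orient /along /cross /=; ring. Qed.

Lemma cross_opp u d : cross u (opp d) = - cross u d.
Proof. rewrite /cross /opp /=; ring. Qed.

(** A vector parallel to two independent vectors vanishes. *)
Lemma cross_basis (u v d : plane R) :
  cross u v != 0 -> cross u d = 0 -> cross v d = 0 -> d = (0, 0).
Proof.
move=> uv ud vd; rewrite [d]surjective_pairing; congr (_, _);
  apply: (mulIf uv); rewrite mul0r.
- transitivity (v.1 * cross u d - u.1 * cross v d); last by rewrite ud vd; ring.
  by rewrite /cross; ring.
- transitivity (v.2 * cross u d - u.2 * cross v d); last by rewrite ud vd; ring.
  by rewrite /cross; ring.
Qed.

Lemma crossC u v : cross u v = - cross v u.
Proof. rewrite /cross; ring. Qed.

(** Among the directions u + t v, each nonzero vector is parallel to at most one,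
so a large t avoids any finite list.  Having u and v arbitrary allows the
direction to be chosen inside a prescribed angular sector. *)
Lemma exists_generic_direction (u v : plane R) (s : seq (plane R)) :
  cross u v != 0 ->
  exists2 t, 0 < t & forall e, e \in s -> e != (0, 0) ->
    cross e (along u t v) != 0.
Proof.
move=> uv0.
(* The only t to be avoided for e is - cross e u / cross e v. *)
pose B := \sum_(e <- s) `|cross e u / cross e v|.
have B0 : 0 <= B by apply: sumr_ge0.
exists (1 + B); first lra.
move=> e es e0; apply/negP => /eqP h.
have h' : cross e u + (1 + B) * cross e v = 0.
  by rewrite -h /cross /along /=; ring.
have [ev0|ev0] := eqVneq (cross e v) 0.
  have eu0 : cross e u = 0 by move: h'; rewrite ev0 mulr0 addr0.
  move/eqP: e0; apply; apply: (cross_basis uv0).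
    by rewrite crossC eu0 oppr0.
  by rewrite crossC ev0 oppr0.
have : cross e u / cross e v = - (1 + B).
  by apply: (mulIf ev0); rewrite divfK //; lra.
move=> /(congr1 Num.norm); rewrite normrN (@ger0_norm _ (1 + B)); last lra.
have : `|cross e u / cross e v| <= B.
  rewrite /B (big_rem e) //= lerDl; exact: sumr_ge0.
lra.
Qed.

End Plane.

Section Distance.
Variable R : realType.
Implicit Types (x y z M : plane R) (r : R).

Lemma edist_ge0 x y : 0 <= edist x y.
Proof. exact: sqrtr_ge0. Qed.

Lemma edistxx x : edist x x = 0.
Proof. by rewrite /edist !subrr expr0n /= addr0 sqrtr0. Qed.

Lemma edistC x y : edist x y = edist y x.
Proof. by rewrite /edist; congr (Num.sqrt _); ring. Qed.

Lemma edist_sqr x y : edist x y ^+ 2 = (x.1 - y.1) ^+ 2 + (x.2 - y.2) ^+ 2.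
Proof. by rewrite sqr_sqrtr // addr_ge0 ?sqr_ge0. Qed.

Lemma edist_le x y r : 0 <= r ->
  (edist x y <= r) = ((x.1 - y.1) ^+ 2 + (x.2 - y.2) ^+ 2 <= r ^+ 2).
Proof.
by move=> r0; rewrite -edist_sqr ler_sqr ?nnegrE ?edist_ge0.
Qed.

Lemma edist_triangle y x z : edist x z <= edist x y + edist y z.
Proof.
have p0 := edist_ge0 x y; have q0 := edist_ge0 y z.
rewrite edist_le ?addr_ge0 //.
have := edist_sqr x y; have := edist_sqr y z.
set p := edist x y in p0 *; set q := edist y z in q0 *.
set u1 := y.1 - z.1; set u2 := y.2 - z.2.
set v1 := x.1 - y.1; set v2 := x.2 - y.2 => hq hp.
have -> : x.1 - z.1 = u1 + v1 by rewrite /u1 /v1; ring.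
have -> : x.2 - z.2 = u2 + v2 by rewrite /u2 /v2; ring.
(* Cauchy-Schwarz, from Lagrange's identity. *)
have cs : u1 * v1 + u2 * v2 <= p * q.
  rewrite -[leRHS]ger0_norm ?mulr_ge0 // ; apply: le_trans (ler_norm _) _.
  rewrite -ler_sqr ?nnegrE // !real_normK ?num_real // exprMn hp hq.
  rewrite -subr_ge0.
  have -> : (v1 ^+ 2 + v2 ^+ 2) * (u1 ^+ 2 + u2 ^+ 2) - (u1 * v1 + u2 * v2) ^+ 2
     = (u1 * v2 - u2 * v1) ^+ 2 by ring.
  exact: sqr_ge0.
nra.
Qed.

Lemma edist_fst x y : `|x.1 - y.1| <= edist x y.
Proof.
rewrite -ler_sqr ?nnegrE ?edist_ge0 // edist_sqr real_normK ?num_real //.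
by rewrite lerDl sqr_ge0.
Qed.

Lemma edist_snd x y : `|x.2 - y.2| <= edist x y.
Proof.
rewrite -ler_sqr ?nnegrE ?edist_ge0 // edist_sqr real_normK ?num_real //.
by rewrite lerDr sqr_ge0.
Qed.

Lemma edist_lt x y r : 0 < r ->
  `|x.1 - y.1| < r / 2 -> `|x.2 - y.2| < r / 2 -> edist x y < r.
Proof.
move=> r0; rewrite !ltr_norml => /andP[h1 h2] /andP[h3 h4].
rewrite -ltr_sqr ?nnegrE ?edist_ge0 ?(ltW r0) // edist_sqr; nra.
Qed.

Lemma edist_along x r (d : plane R) : 0 <= r ->
  edist (along x r d) x = r * edist d (0, 0).
Proof.
move=> r0; rewrite /edist /along /= !subr0.
rewrite (addrC x.1) (addrC x.2) !addrK.
by rewrite !exprMn -mulrDr sqrtrM ?sqr_ge0 // sqrtr_sqr ger0_norm.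
Qed.

End Distance.

(** * Convex polygons *)

Section Polygon.
Variables (R : realType) (n : nat).
Hypothesis n_ge3 : (3 <= n)%N.
Implicit Types (p : 'I_n -> plane R) (i k : 'I_n) (A : set (plane R)).
Implicit Types (x y d : plane R).

(** Throughout, side i of the polygon p runs from [p i] to [p (ordS i)], and
[lside p i] is the affine form that is nonnegative on the polygon and vanishes
along that side. *)
Definition edge p i := vec (p i) (p (ordS i)).
Definition lside p i x := orient (p i) (p (ordS i)) x.

(** Extreme points do not refer to a list of corners: they serve to identify the
corners of a tile found in two different lists. *)
Definition extreme A x :=
  A x /\ forall d s, 0 < s -> A (along x s d) -> A (along x (- s) d) ->
    d = (0, 0).

Definition enters d A x :=
  A x /\ exists2 s0, 0 < s0 &
    forall s, 0 < s -> s < s0 -> interior A (along x s d).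

Lemma ordS_neq i : ordS i != i.
Proof.
apply/eqP => /(congr1 val) /=; case: i => i /= ilt.
have [h|h] := ltnP i.+1 n; first by rewrite modn_small // => /eqP; rewrite eqn_leq ltnn.
have -> : i.+1 = n by apply/eqP; rewrite eqn_leq ilt h.
by rewrite modnn => i0; move: h n_ge3; rewrite -i0; case: (n) => [|[|[|]]].
Qed.

Lemma ordSS_neq i : ordS (ordS i) != i.
Proof.
apply/eqP => /(congr1 val) /=; case: i => i /= ilt.
have [h|h] := ltnP i.+1 n.
  rewrite (modn_small h); have [h'|h'] := ltnP i.+2 n.
    by rewrite modn_small // => /eqP; rewrite eqn_leq ltnNge leqnSn.
  have -> : i.+2 = n by apply/eqP; rewrite eqn_leq h h'.
  by rewrite modnn => i0; move: h' n_ge3; rewrite -i0; case: (n) => [|[|[|]]].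
have e : i.+1 = n by apply/eqP; rewrite eqn_leq ilt h.
rewrite e modnn modn_small; last exact: leq_trans n_ge3.
by move=> i1; move: e n_ge3; rewrite -i1 => <-.
Qed.

Lemma ord_pred_neqS i : ord_pred i != ordS i.
Proof.
apply/eqP => h; have := ordSS_neq (ord_pred i).
by rewrite ord_predK -h eqxx.
Qed.

Lemma lside_along p i x s d :
  lside p i (along x s d) = lside p i x + s * cross (edge p i) d.
Proof. exact: orient_along. Qed.

Section Corners.
Variables (A : set (plane R)) (p : 'I_n -> plane R).
Hypothesis Ap : corners_of A p.

Lemma lside_l i : lside p i (p i) = 0.
Proof. rewrite /lside /orient; ring. Qed.

Lemma lside_r i : lside p i (p (ordS i)) = 0.
Proof. rewrite /lside /orient; ring. Qed.

Lemma lside_pred i : lside p (ord_pred i) (p i) = 0.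
Proof. by have := lside_r (ord_pred i); rewrite ord_predK. Qed.

Lemma lside_gt0 i k : k != i -> k != ordS i -> 0 < lside p i (p k).
Proof. by case: Ap => h _; exact: h. Qed.

Lemma lside_ge0 i k : 0 <= lside p i (p k).
Proof.
have [->|ki] := eqVneq k i; first by rewrite lside_l.
have [->|ki'] := eqVneq k (ordS i); first by rewrite lside_r.
exact/ltW/lside_gt0.
Qed.

Lemma lside_eq0 i k : lside p i (p k) = 0 -> k = i \/ k = ordS i.
Proof.
have [->|ki] := eqVneq k i; first by left.
have [->|ki'] := eqVneq k (ordS i); first by right.
by have := lside_gt0 ki ki'; rewrite lt_neqAle => /andP[/eqP h _] /esym.
Qed.

Lemma lside_hull i (l : 'I_n -> R) : \sum_k l k = 1 ->
  lside p i (\sum_k l k * (p k).1, \sum_k l k * (p k).2) =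
  \sum_k l k * lside p i (p k).
Proof.
move=> l1; set u := (edge p i).1; set v := (edge p i).2.
transitivity (\sum_k (u * (l k * (p k).2) - v * (l k * (p k).1) -
    (u * (p i).2 - v * (p i).1) * l k)).
  rewrite !sumrB -!mulr_sumr l1 /lside /orient /= /u /v /=; ring.
by apply: eq_bigr => k _; rewrite /lside /orient /= /u /v /=; ring.
Qed.

Lemma sum_three_deltas (j1 j2 j3 : 'I_n) (a b c : R) (f : 'I_n -> R) :
  \sum_i (a * (i == j1)%:R + b * (i == j2)%:R + c * (i == j3)%:R) * f i =
  a * f j1 + b * f j2 + c * f j3.
Proof.
have sum1 j (e : R) : \sum_i e * (i == j)%:R * f i = e * f j.
  rewrite (bigD1 j) //= eqxx mulr1 big1 ?addr0 // => i /negbTE ->.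
  by rewrite mulr0 mul0r.
rewrite -(sum1 j1 a) -(sum1 j2 b) -(sum1 j3 c) -!big_split.
by apply: eq_bigr => i _; rewrite !mulrDl.
Qed.

Lemma triangle_hull (j1 j2 j3 : 'I_n) y :
  0 < orient (p j1) (p j2) (p j3) ->
  0 <= orient (p j1) (p j2) y -> 0 <= orient (p j2) (p j3) y ->
  0 <= orient (p j3) (p j1) y -> hull p y.
Proof.
set S := orient (p j1) _ _; set c := orient _ _ y; set a := orient _ _ y.
set b := orient _ _ y => S0 c0 a0 b0.
have Sn : S != 0 by rewrite gt_eqF.
have Sabc : S = a + b + c by rewrite /S /a /b /c /orient; ring.
exists (fun i => a / S * (i == j1)%:R + b / S * (i == j2)%:R
                 + c / S * (i == j3)%:R); split.
- by move=> i; rewrite !addr_ge0 // mulr_ge0 ?ler0n // divr_ge0 // ltW.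
- have := sum_three_deltas j1 j2 j3 (a / S) (b / S) (c / S) (fun=> 1).
  by under eq_bigr do rewrite mulr1; rewrite !mulr1 -!mulrDl -Sabc divff.
- rewrite !(sum_three_deltas _ _ _ _ _ _ (fun i => (p i).1)).
  rewrite !(sum_three_deltas _ _ _ _ _ _ (fun i => (p i).2)).
  rewrite [LHS]surjective_pairing; congr (_, _).
    by apply: (mulIf Sn); rewrite !mulrDl ![_ / S * _ * S]mulrAC !divfK //
      /S /a /b /c /orient; ring.
  by apply: (mulIf Sn); rewrite !mulrDl ![_ / S * _ * S]mulrAC !divfK //
      /S /a /b /c /orient; ring.
Qed.

End Corners.
End Polygon.

(** A point to the left of all sides lies in one of the triangles of the fan with
apex [p 0]: going round the polygon, the point passes from the left to the right
of the diagonal from [p 0] to [p k]. *)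
Lemma halfplanes_hull (R : realType) n (p : 'I_n -> plane R) y :
  (3 <= n)%N ->
  (forall i k : 'I_n, k != i -> k != ordS i ->
     0 < orient (p i) (p (ordS i)) (p k)) ->
  (forall i, 0 <= lside p i y) -> hull p y.
Proof.
case: n p => [//|m] p m3 conv y_in.
have S_in k : (k < m)%N -> ordS (inord k : 'I_m.+1) = inord k.+1.
  move=> km; apply: val_inj; rewrite /= !inordK //; last exact: ltnW.
  by rewrite modn_small.
pose q k := p (inord k).
have side k : (k < m)%N -> 0 <= orient (q k) (q k.+1) y.
  by move=> km; have := y_in (inord k); rewrite /lside S_in.
have last_side : orient (q 0%N) (q m) y <= 0.
  have := y_in (inord m); rewrite /lside.
  have -> : ordS (inord m : 'I_m.+1) = inord 0.
    by apply: val_inj; rewrite /= !inordK // modnn.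
  rewrite -/(q m) -/(q 0%N) => h; rewrite -oppr_ge0; apply: le_trans h _.
  by rewrite le_eqVlt; apply/orP; left; apply/eqP; rewrite /orient; ring.
have [k [k0 km gk gk1]] : exists k, [/\ (0 < k)%N, (k < m)%N,
    0 <= orient (q 0%N) (q k) y & orient (q 0%N) (q k.+1) y <= 0].
  (* k + 1 is the first diagonal from corner 0, side 0 aside, that does not have y
     strictly on its left; the last side is such a diagonal. *)
  have m1 : (1 <= m)%N by rewrite -ltnS ltnW.
  have exP : exists k, (1 < k)%N && (orient (q 0%N) (q k) y <= 0).
    by exists m; rewrite last_side andbT -ltnS.
  case: (ex_minnP exP) => k /andP[k1 gk] kmin.
  have km : (k <= m)%N by apply: kmin; rewrite last_side andbT -ltnS.
  exists k.-1; rewrite prednK ?(ltnW k1) //; split => //.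
  - by rewrite -ltnS prednK // ltnW.
  - rewrite leNgt; apply/negP => h.
    have [k2|k2] := ltnP 1 k.-1.
      have := kmin k.-1; rewrite k2 (ltW h) => /(_ isT).
      by rewrite leqNgt prednK ?leqnn // ltnW.
    have k1' : k.-1 = 1%N.
      by apply/eqP; rewrite eqn_leq k2 -ltnS prednK // ltnW.
    by have := side 0%N (ltnW m3); rewrite leNgt -k1' h.
apply: (@triangle_hull _ _ p (inord 0) (inord k) (inord k.+1)) => //.
- have := conv (inord k) (inord 0); rewrite S_in // => h.
  apply: lt_le_trans (h _ _) _.
  + by apply/eqP => /(congr1 val); rewrite /= !inordK //; [case: (k) k0|exact: ltnW].
  + by apply/eqP => /(congr1 val); rewrite /= !inordK.
  + by rewrite le_eqVlt; apply/orP; left; apply/eqP; rewrite /orient; ring.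
- exact: side.
- rewrite -oppr_le0; apply: le_trans gk1.
  by rewrite le_eqVlt; apply/orP; left; apply/eqP; rewrite /q /orient; ring.
Qed.

Lemma orient_continuous (R : realType) (a b : plane R) : continuous (orient a b).
Proof.
move=> x; rewrite /orient.
apply: cvgB; apply: cvgM; try exact: cvg_cst; apply: cvgB; try exact: cvg_cst.
- exact: cvg_snd.
- exact: cvg_fst.
Qed.

Section ConvexPolygon.
Variables (R : realType) (n : nat).
Hypothesis n_ge3 : (3 <= n)%N.
Variables (A : set (plane R)) (p : 'I_n -> plane R).
Hypothesis Ap : corners_of A p.
Implicit Types (i k : 'I_n) (x y d : plane R).

(** The polygon as an intersection of half-planes: this turns membership into the
signs of finitely many affine forms. *)
Lemma polygonP x : A x <-> forall i, 0 <= lside p i x.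
Proof.
split=> [|x_in]; last first.
  by case: Ap => conv ->; exact: halfplanes_hull.
case: (Ap) => _ {1}-> [l [l0 l1 ->]] i.
rewrite lside_hull //; apply: sumr_ge0 => k _.
by rewrite mulr_ge0 // (lside_ge0 Ap).
Qed.

Lemma polygon_interior x : (forall i, 0 < lside p i x) -> interior A x.
Proof.
move=> x_in; rewrite /interior.
have near_in : \forall y \near x, forall i, 0 < lside p i y.
  apply: (@filter_forall _ _ (fun i y => 0 < lside p i y) (nbhs x)) => i.
  exact: (@orient_continuous R (p i) (p (ordS i)) x) (lt_nbhsr (x_in i)).
by apply: filterS near_in => y y_in; apply/polygonP => i; exact: ltW.
Qed.

Lemma corner_in i : A (p i).
Proof. by apply/polygonP => k; exact: (lside_ge0 Ap). Qed.

Lemma corner_inj : injective p.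
Proof.
move=> i k pik; apply/eqP/negPn/negP; rewrite eq_sym => ki.
have [/eqP kS|kS] := boolP (k == ordS i).
  have := lside_gt0 Ap (i := ord_pred i) (k := k).
  rewrite ord_predK -pik lside_pred ltxx kS eq_sym ord_pred_neqS // ordS_neq //.
  by move=> /(_ isT isT).
by have := lside_gt0 Ap ki kS; rewrite -pik lside_l ltxx.
Qed.

Lemma edge_cross i : 0 < cross (edge p (ord_pred i)) (edge p i).
Proof.
have := lside_gt0 Ap (i := ord_pred i) (k := ordS i).
rewrite ord_predK eq_sym ord_pred_neqS // ordS_neq // => /(_ isT isT).
rewrite /lside /orient /cross /edge ord_predK /=; lra.
Qed.

Lemma edge_neq0 i : edge p i != (0, 0).
Proof.
apply/eqP => e0; have := edge_cross i; rewrite e0 /cross /=; lra.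
Qed.

(** Moving both ways along d from a corner without leaving the polygon forces d to
be parallel to both sides at that corner. *)
Lemma extreme_corner i : extreme A (p i).
Proof.
split; first exact: corner_in.
move=> d s s0 /polygonP As /polygonP Ams.
have cross0 k : lside p k (p i) = 0 -> cross (edge p k) d = 0.
  move=> ki; have := As k; have := Ams k; rewrite !lside_along ki !add0r.
  rewrite mulNr oppr_ge0 => h1 h2.
  have /eqP : s * cross (edge p k) d = 0 by apply/eqP; rewrite eq_le h1 h2.
  by rewrite mulf_eq0 gt_eqF //= => /eqP.
have := edge_cross i => /gt_eqF/negbT/cross_basis; apply; apply: cross0.
  exact: lside_pred.
exact: lside_l.
Qed.

(** A convex combination giving a positive weight to a corner [p i] other than x
can be moved both towards and away from [p i], so that x is not extreme. *)
Lemma corner_of_extreme x : extreme A x -> exists i, x = p i.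
Proof.
move=> [Ax ext]; case: (Ap) => _ defA.
have := Ax; rewrite {1}defA => -[l [l0 l1 defx]].
have [i li] : exists i, 0 < l i.
  apply/existsP; rewrite -[X in is_true X]negbK negb_exists; apply/negP => /forallP h.
  have : \sum_i l i <= 0 by apply: sumr_le0 => i _; rewrite leNgt h.
  by rewrite l1; lra.
have li1 : l i <= 1.
  by rewrite -l1 (bigD1 i) //= lerDl; apply: sumr_ge0.
have sd k : l i * lside p k (p i) <= lside p k x.
  rewrite defx lside_hull // (bigD1 i) //= lerDl.
  by apply: sumr_ge0 => j _; rewrite mulr_ge0 // (lside_ge0 Ap).
exists i.
have d0 : vec (p i) x = (0, 0).
  apply: (ext _ (l i)) => //; apply/polygonP => k; have := sd k;
    have := lside_ge0 Ap k i; have := (polygonP x).1 Ax k; rewrite lside_along;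
    have -> : cross (edge p k) (vec (p i) x) = lside p k x - lside p k (p i)
      by rewrite /lside /orient /cross /edge /vec /=; ring.
  - move=> *; nra.
  - move=> *; nra.
rewrite [x]surjective_pairing [p i]surjective_pairing.
by move: d0 => [] /eqP + /eqP; rewrite !subr_eq0 => /eqP -> /eqP ->.
Qed.

(** Only the sides through x restrict the directions pointing inside. *)
Lemma enters_of_sides d x : A x ->
  (forall i, lside p i x = 0 -> 0 < cross (edge p i) d) -> enters d A x.
Proof.
move=> Ax dir; split=> //.
pose q i := `|cross (edge p i) d| / lside p i x.
have q0 i : 0 <= q i by rewrite divr_ge0 // (polygonP x).1.
pose Q := 1 + \sum_i q i.
have Q1 : 1 <= Q by rewrite lerDl sumr_ge0.
have Q0 : 0 < Q by apply: lt_le_trans Q1.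
(* With s Q < 1, the decrease of each positive form is smaller than its value;
   for a form vanishing at x the quotient q i is 0 by convention. *)
exists Q^-1; first by rewrite invr_gt0.
move=> s s0; rewrite -(ltr_pM2r Q0) mulVf ?gt_eqF // => sQ.
apply: polygon_interior => i; rewrite lside_along.
have := (polygonP x).1 Ax i; rewrite le_eqVlt => /orP[/eqP/esym h0|h0].
  by rewrite h0 add0r mulr_gt0 // dir.
have qQ : q i < Q.
  by rewrite /Q (bigD1 i) //= ltr_pwDl // lerDl sumr_ge0.
have sq : s * q i < 1 by apply: lt_trans sQ; rewrite ltr_pM2l.
have : s * `|cross (edge p i) d| < lside p i x.
  by rewrite -[X in _ < X]mul1r -ltr_pdivrMr // -mulrA.
have : - `|cross (edge p i) d| <= cross (edge p i) d.
  by rewrite lerNl -normrN ler_norm.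
move=> *; nra.
Qed.

Lemma enters_sides d x i : enters d A x -> lside p i x = 0 ->
  0 <= cross (edge p i) d.
Proof.
move=> [_ [s0 s00 h]] i0.
have : A (along x (s0 / 2) d) by apply: interior_subset; apply: h; lra.
move=> /polygonP /(_ i); rewrite lside_along i0 add0r pmulr_rge0 //; lra.
Qed.

(** In a generic direction one further point of the polygon is enough, since the
segment cannot run along a side. *)
Lemma enters_of_point d x s : (forall i, cross (edge p i) d != 0) ->
  0 < s -> A x -> A (along x s d) -> enters d A x.
Proof.
move=> gen s0 Ax /polygonP Ay; apply: enters_of_sides => // i i0.
have := Ay i; rewrite lside_along i0 add0r pmulr_rge0 // => h.
by rewrite lt_neqAle eq_sym gen.
Qed.

Lemma enters_corner d i : (forall k, cross (edge p k) d != 0) ->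
  enters d A (p i) <->
  0 < cross (edge p (ord_pred i)) d /\ 0 < cross (edge p i) d.
Proof.
move=> gen; split=> [h|[h1 h2]].
  rewrite !lt_neqAle !(eq_sym 0) !gen /=; split; apply: (enters_sides h).
    exact: lside_pred.
  exact: lside_l.
apply: enters_of_sides; first exact: corner_in.
move=> k /(lside_eq0 Ap) [<- //|kS].
by move: h1; rewrite kS ordSK.
Qed.

(** Inside a side the polygon fills a half-disk, into which one of two opposite
directions points. *)
Lemma enters_side d x i : (forall k, cross (edge p k) d != 0) ->
  segment (p i) (p (ordS i)) x -> x != p i -> x != p (ordS i) ->
  enters d A x \/ enters (opp d) A x.
Proof.
move=> gen [t [t0 t1 defx]] xi xS.
have tn0 : 0 < t.
  rewrite lt_neqAle t0 andbT eq_sym; apply: contraNneq xi => t00.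
  by rewrite defx t00 subr0 !mul1r !mul0r !addr0 -surjective_pairing.
have tn1 : t < 1.
  rewrite lt_neqAle t1 andbT; apply: contraNneq xS => t00.
  by rewrite defx t00 subrr !mul1r !mul0r !add0r -surjective_pairing.
have lsx k : lside p k x = (1 - t) * lside p k (p i) + t * lside p k (p (ordS i)).
  by rewrite defx /lside /orient /=; ring.
have Ax : A x.
  by apply/polygonP => k; rewrite lsx addr_ge0 // mulr_ge0 ?(lside_ge0 Ap) //; lra.
have only k : lside p k x = 0 -> k = i.
  rewrite lsx => h.
  have a0 := lside_ge0 Ap k i; have b0 := lside_ge0 Ap k (ordS i).
  have /(lside_eq0 Ap)[//|ki] : lside p k (p i) = 0 by nra.
  have /(lside_eq0 Ap)[kS|/ordS_inj-> //] : lside p k (p (ordS i)) = 0 by nra.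
  by move: (ordSS_neq n_ge3 i); rewrite kS -ki eqxx.
have [c0|c0|c0] := ltrgtP 0 (cross (edge p i) d).
- by left; apply: enters_of_sides => // k /only ->.
- by right; apply: enters_of_sides => // k /only ->; rewrite cross_opp; lra.
- by move: (gen i); rewrite -c0 eqxx.
Qed.

End ConvexPolygon.

(** * A convex n-gon is entered at n - 2 corners *)

Section PolygonCount.
Variables (R : realType) (n : nat).
Hypothesis n_ge3 : (3 <= n)%N.
Variables (A : set (plane R)) (p : 'I_n -> plane R).
Hypothesis Ap : corners_of A p.
Implicit Types (i k : 'I_n) (x y d : plane R).

(** The linear form [cross _ d] increases along the side before corner i and
decreases along the side after it: corner i is a local maximum. *)
Definition peak d i :=
  (0 < cross (edge p (ord_pred i)) d) && (cross (edge p i) d < 0).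

(** The polygon lies in the angular sector at [p i], so by convexity a local
maximum is a strict global one. *)
Lemma peak_max d i k : peak d i -> k != i -> cross (p k) d < cross (p i) d.
Proof.
move=> /andP[up down] ki.
have a0 : 0 <= lside p (ord_pred i) (p k) := lside_ge0 Ap _ _.
have b0 : 0 <= lside p i (p k) := lside_ge0 Ap _ _.
have D0 := edge_cross n_ge3 Ap i.
(* Expansion of p k - p i in the basis formed by the two sides at p i. *)
have key : cross (edge p (ord_pred i)) (edge p i) * (cross (p k) d - cross (p i) d)
   = lside p (ord_pred i) (p k) * cross (edge p i) d
     - lside p i (p k) * cross (edge p (ord_pred i)) d.
  by rewrite /lside /orient /cross /edge /vec ord_predK /=; ring.
rewrite -subr_lt0 -(pmulr_rlt0 _ D0) key.
have [kS|kS] := eqVneq k (ordS i).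
  have : 0 < lside p (ord_pred i) (p k).
    by apply: (lside_gt0 Ap); rewrite ?ord_predK // kS eq_sym ord_pred_neqS.
  move=> a1; nra.
have : 0 < lside p i (p k) by exact: (lside_gt0 Ap).
move=> b1; nra.
Qed.

Lemma one_peak d : (forall i, cross (edge p i) d != 0) ->
  (\sum_i (peak d i : nat) = 1)%N.
Proof.
move=> gen.
have n0 : (0 < n)%N by exact: ltn_trans n_ge3.
pose i := [arg max_(i > Ordinal n0) cross (p i) d]%O.
have imax k : cross (p k) d <= cross (p i) d.
  by rewrite /i; case: Order.TotalTheory.arg_maxP => // j _; apply.
have crossE k : cross (edge p k) d = cross (p (ordS k)) d - cross (p k) d.
  by rewrite /cross /edge /vec /=; ring.
have pk : peak d i.
  rewrite /peak !lt_neqAle (eq_sym 0) !gen /= !crossE ord_predK.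
  by rewrite subr_ge0 subr_le0 !imax.
rewrite (bigD1 i) //= pk big1 // => k ki.
apply/eqP; rewrite eqb0; apply/negP => pk'.
by have := imax k; rewrite leNgt (peak_max pk') // eq_sym.
Qed.

(** At a corner neither direction points inside exactly when the form increases on
one adjacent side and decreases on the other, that is, at the unique peak for d
and at the unique peak for the opposite direction. *)
Lemma enter_count d : (forall i, cross (edge p i) d != 0) ->
  (\sum_i (`[< enters d A (p i) >] + `[< enters (opp d) A (p i) >]) = n - 2)%N.
Proof.
move=> gen.
have gen' i : cross (edge p i) (opp d) != 0 by rewrite cross_opp oppr_eq0.
suff : (\sum_i (`[< enters d A (p i) >] + `[< enters (opp d) A (p i) >]) +
   \sum_i (peak d i : nat) + \sum_i (peak (opp d) i : nat) = n)%N.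
  rewrite !one_peak // => e; apply/eqP.
  rewrite -(eqn_add2r 2) subnK ?(ltnW n_ge3) //.
  by rewrite addn2 -addn1 -[X in (X + 1)%N]addn1 e.
rewrite -!big_split /= -[RHS]card_ord -sum1_card; apply: eq_bigr => i _.
have asE (P : Prop) (b : bool) : (P <-> b) -> `[< P >] = b.
  by move=> h; apply/asboolP/idP => /h.
rewrite (asE _ ((0 < cross (edge p (ord_pred i)) d) && (0 < cross (edge p i) d))).
  rewrite (asE _ ((cross (edge p (ord_pred i)) d < 0) && (cross (edge p i) d < 0))).
    rewrite /peak !cross_opp !oppr_gt0 !oppr_lt0.
    move: (gen i) (gen (ord_pred i)).
    by case: (ltrgtP 0 (cross (edge p i) d));
      case: (ltrgtP 0 (cross (edge p (ord_pred i)) d)).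
  rewrite enters_corner // !cross_opp !oppr_gt0; split=> [[-> ->] //|/andP[]//].
rewrite enters_corner //; split=> [[-> ->] //|/andP[]//].
Qed.

End PolygonCount.

(** * Limits along a function of polynomial growth *)

Section Growth.
Variable R : realType.

Lemma bernoulli (e : R) m : 0 <= e -> 1 + m%:R * e <= (1 + e) ^+ m.
Proof.
move=> e0; elim: m => [|m IH]; first by rewrite mul0r addr0 expr0.
rewrite exprS -natr1; have : 0 <= m%:R :> R by [].
move: IH; set x := _ ^+ m; set y := m%:R => *; nra.
Qed.

(** If every step of length c multiplied a by more than 1 + e, then a would grow
exponentially, against the quadratic bound. *)
Lemma no_exponential_growth (a : R -> nat) (G c e r0 : R) :
  0 <= r0 -> 0 < c -> 0 < e ->
  (forall r, r0 <= r -> (0 < a r)%N) ->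
  (forall r, 0 <= r -> (a r)%:R <= (G * (r + 1)) ^+ 2 :> R) ->
  exists2 r, r0 <= r & (a (r + c))%:R <= (1 + e) * (a r)%:R :> R.
Proof.
move=> r00 c0 e0 a_gt0 a_le; apply: contrapT => no.
have step r : r0 <= r -> (1 + e) * (a r)%:R < (a (r + c))%:R :> R.
  by move=> rr; rewrite ltNge; apply/negP => h; apply: no; exists r.
have low k : (1 + e) ^+ k <= (a (r0 + k%:R * c))%:R :> R.
  elim: k => [|k IH]; first by rewrite mul0r addr0 expr0 ler1n a_gt0.
  rewrite -natr1 mulrDl mul1r addrA exprS.
  have kc : 0 <= k%:R * c by rewrite mulr_ge0 // ltW.
  have := step (r0 + k%:R * c); rewrite lerDl => /(_ kc) /ltW; apply: le_trans.
  by rewrite ler_pM2l // ltr_wpDl.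
pose H := (G * (r0 + 3 * c + 1)) ^+ 2.
have H0 : 0 <= H by exact: sqr_ge0.
have e3 : 0 < e ^+ 3 by exact: exprn_gt0.
(* After 3 m steps a is at least (1 + m e)^3, which is cubic in m. *)
have [m [m1 mH]] : exists m, (0 < m)%N /\ H < m%:R * e ^+ 3.
  exists (Num.truncn (H / e ^+ 3)).+1; split=> //.
  by rewrite -ltr_pdivrMr // truncnS_gt.
have mR : 1 <= m%:R :> R by rewrite ler1n.
have b := bernoulli m (ltW e0).
have me0 : 0 <= m%:R * e by rewrite mulr_ge0 // ltW.
have lo : (m%:R * e) ^+ 3 <= (a (r0 + (m * 3)%:R * c))%:R :> R.
  apply: le_trans (low _); rewrite exprM lerXn2r // ?nnegrE ?exprn_ge0 //; lra.
have hi : (a (r0 + (m * 3)%:R * c))%:R <= m%:R ^+ 2 * H :> R.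
  apply: le_trans (a_le _ _) _.
    by rewrite addr_ge0 // mulr_ge0 // ltW.
  have p1 : 0 <= r0 + (m * 3)%:R * c + 1 by rewrite !addr_ge0 // mulr_ge0 // ltW.
  have p2 : 0 <= r0 + 3 * c + 1 by rewrite !addr_ge0 // mulr_ge0 // ltW.
  rewrite /H !exprMn [leRHS]mulrCA.
  rewrite ler_wpM2l ?sqr_ge0 // -exprMn.
  by rewrite lerXn2r ?nnegrE ?(mulr_ge0 _ p2) // natrM; nra.
have := le_trans lo hi; rewrite exprMn [_ ^+ 3]exprSr -mulrA.
rewrite ler_pM2l ?exprn_gt0 ?ltr0n //.
by rewrite leNgt mH.
Qed.

(** The lower bound on X holds for all r, whereas the upper bound is only useful
along the radii given by [no_exponential_growth]; this is why the existence of
the limit has to be assumed. *)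
Lemma limit_of_sandwich (a : R -> nat) (t X : R -> R) (G c w L : R) :
  0 < c -> 0 <= w ->
  (forall r, c <= r -> (0 < a r)%N) ->
  (forall r, 0 <= r -> (a r)%:R <= (G * (r + 1)) ^+ 2 :> R) ->
  (forall r, 0 <= r -> (a r)%:R <= t r) ->
  (forall r, 0 <= r -> w * t r <= X r <= w * (a (r + c))%:R) ->
  X r / t r @[r --> +oo] --> L -> L = w.
Proof.
move=> c0 w0 a_gt0 a_le a_t sand XL.
have close (e : R) : 0 < e -> exists r0, forall r, r0 < r -> `|L - X r / t r| < e.
  move=> e0; have [r0 [_ h]] := (cvgrPdist_lt _ L).1 XL e e0.
  by exists r0.
apply/eqP; rewrite eq_le; apply/andP; split; apply/ler_addgt0Pr => e e0.
- have e2 : 0 < e / 2 by rewrite divr_gt0.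
  have [r0 close0] := close _ e2.
  pose d := e / 2 / (w + 1).
  have d0 : 0 < d by rewrite divr_gt0 // ltr_wpDl.
  have r1c : c <= Num.max c (r0 + 1) by rewrite le_max lexx.
  have [|//|//||//|r r1 ar] := @no_exponential_growth a G c d (Num.max c (r0 + 1)).
  + by rewrite (le_trans (ltW c0)).
  + by move=> r hr; apply: a_gt0; exact: le_trans hr.
  + have rc : c <= r by exact: le_trans r1.
    have rr0 : r0 < r by apply: lt_le_trans r1; rewrite lt_max ltrDl ltr01 orbT.
    have := close0 r rr0; have r0' : 0 <= r by rewrite (le_trans (ltW c0)).
    have ar0 : 0 < (a r)%:R :> R by rewrite ltr0n a_gt0.
    have t0 : 0 < t r by exact: lt_le_trans (a_t r r0').
    have /andP[_ Xle] := sand r r0'.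
    have : X r / t r <= w * (1 + d).
      rewrite ler_pdivrMr //; apply: le_trans Xle _; rewrite -mulrA ler_wpM2l //.
      by apply: le_trans ar _; rewrite ler_wpM2l ?a_t // addr_ge0 // ltW.
    have : w * d <= e / 2.
      rewrite /d mulrA ler_pdivrMr ?ltr_wpDl // mulrC ler_wpM2l ?(ltW e2) //; lra.
    rewrite ltr_norml => h1 h2 /andP[h3 h4]; lra.
- have [r0 close0] := close _ e0.
  pose r := Num.max c (r0 + 1).
  have rc : c <= r by rewrite le_max lexx.
  have rr0 : r0 < r by rewrite lt_max ltrDl ltr01 orbT.
  have := close0 r rr0; have r0' : 0 <= r by rewrite (le_trans (ltW c0)).
  have ar0 : 0 < (a r)%:R :> R by rewrite ltr0n a_gt0.
  have t0 : 0 < t r by exact: lt_le_trans (a_t r r0').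
  have /andP[Xge _] := sand r r0'.
  have : w <= X r / t r by rewrite ler_pdivlMr.
  rewrite ltr_norml => h1 /andP[h3 h4]; lra.
Qed.

Lemma bounded_affine (a b K : R) : (forall s, 1 <= s -> `|a + s * b| <= K) -> b = 0.
Proof.
move=> h; apply/eqP/negPn/negP => b0.
have b1 : 0 < `|b| by rewrite normr_gt0.
have K0 : 0 <= K by apply: le_trans (h 1 (lexx _)).
have s1 : 1 <= 1 + (K + `|a|) / `|b| by rewrite lerDl divr_ge0 // addr_ge0.
have := h _ s1; set s := 1 + _ in s1 *.
have : `|s * b| <= `|a + s * b| + `|a|.
  by have := ler_normB (a + s * b) a; rewrite addrAC subrr add0r.
have -> : `|s * b| = `|b| + K + `|a|.
  rewrite normrM ger0_norm ?(le_trans ler01) // /s mulrDl mul1r divfK ?gt_eqF //.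
  by rewrite addrA.
lra.
Qed.

(** With [ray_connected], this shows that a ray avoiding a set lies in an unbounded
component of the complement. *)
Lemma ray_unbounded (B : set (plane R)) (x d : plane R) : bounded_set B ->
  (forall s, 1 <= s -> B (along x s d)) -> d = (0, 0).
Proof.
move=> [K [_ /(_ (K + 1))]]; rewrite ltrDl ltr01 => /(_ isT) hB ray.
rewrite [d]surjective_pairing; congr (_, _).
  apply: (@bounded_affine x.1 _ (K + 1)) => s s1.
  by apply: le_trans (hB _ (ray s s1)); rewrite prod_normE le_max lexx.
apply: (@bounded_affine x.2 _ (K + 1)) => s s1.
by apply: le_trans (hB _ (ray s s1)); rewrite prod_normE le_max lexx orbT.
Qed.

Lemma ray_connected (x d : plane R) :
  connected ((fun s => along x s d) @` [set s | 1 <= s]).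
Proof.
apply: connected_continuous_connected.
  apply/connected_intervalP => s t /= s1 t1 z /andP[sz _].
  exact: le_trans sz.
apply: continuous_subspaceT => s.
have aff (a b : R) : a + z * b @[z --> s] --> a + s * b.
  by apply: cvgD; [exact: cvg_cst|apply: cvgMl; exact: cvg_id].
exact: cvg_pair (aff x.1 d.1) (aff x.2 d.2).
Qed.

End Growth.

(** * Cardinality and finite sums *)

Lemma card_ge3 (K : Type) (X : set K) (a b c : K) :
  X a -> X b -> X c -> a <> b -> a <> c -> b <> c -> (`I_3 #<= X)%card.
Proof.
move=> Xa Xb Xc ab ac bc.
pose f k := if k is 0%N then a else if k is 1%N then b else c.
have f_inj : {in `I_3 &, injective f}.
  move=> [|[|[|?]]] [|[|[|?]]]; rewrite !inE //= => _ _;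
    by [move/ab | move/ac | move/bc | move/esym/ab | move/esym/ac | move/esym/bc].
rewrite -(card_le_eql (inj_card_eq f_inj)); apply: subset_card_le.
by move=> _ [[|[|k]] _ <-].
Qed.

Lemma card_ge3_others (K : Type) (a : K) (X : set K) : (`I_3 #<= X)%card ->
  exists b c, [/\ X b, X c, b <> a, c <> a & b <> c].
Proof.
move=> X3.
have small m (g : nat -> K) : (m < 3)%N -> ~ (X `<=` g @` `I_m).
  move=> m3 /subset_card_le Xg; have := card_le_trans Xg (card_image_le g `I_m).
  by move=> /(card_le_trans X3); rewrite card_le_II leqNgt m3.
have [b [Xb ba]] : exists b, X b /\ b <> a.
  apply: contrapT => no; apply: (small 1%N (fun=> a)) => // y Xy.
  by exists 0%N => //; apply: contrapT => ya; apply: no; exists y; split=> // /esym.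
have [c [Xc ca cb]] : exists c, [/\ X c, c <> a & c <> b].
  apply: contrapT => no.
  apply: (small 2%N (fun k => if k is 0%N then a else b)) => // y Xy.
  have [->|ya] := pselect (y = a); first by exists 0%N.
  have [->|yb] := pselect (y = b); first by exists 1%N.
  by exfalso; apply: no; exists y.
by exists b, c; split=> //; exact: nesym.
Qed.

Lemma positive_lower_bound (R : realType) (K : eqType) (s : seq K) (f : K -> R) :
  (forall k, 0 < f k) -> exists2 e, 0 < e & forall k, k \in s -> e <= f k.
Proof.
move=> f0; elim: s => [|a s [e e0 IH]]; first by exists 1.
exists (Num.min (f a) e); first by rewrite lt_min f0 e0.
move=> k; rewrite inE ge_min => /orP[/eqP ->|/IH ->]; last by rewrite orbT.
by rewrite lexx.
Qed.


Lemma fset_set_mem (K : choiceType) (X : set K) x : finite_set X ->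
  (x \in fset_set X) = `[< X x >].
Proof. by move=> fX; rewrite in_fset_set. Qed.

Lemma card_fset_set_sub (K : choiceType) (V : {fset K}) (X Y : set K) :
  finite_set X -> V = fset_set X ->
  #|` fset_set (X `&` Y)| = (\sum_(x <- V) `[< Y x >])%N.
Proof.
move=> fX ->; have fXY : finite_set (X `&` Y) by exact: finite_setIl.
have -> : fset_set (X `&` Y) = [fset x in fset_set X | `[< Y x >]]%fset.
  apply/fsetP => x; rewrite !inE !fset_set_mem //.
  by apply/asboolP/andP => [[? ?]|[/asboolP ? /asboolP ?]]; split=> //; apply/asboolP.
rewrite card_fset_sum1 big_fset /= big_mkcond /=.
by apply: eq_bigr => x _; case: `[< _ >].
Qed.

Lemma sum_one (K : choiceType) (B : {fset K}) (P : K -> Prop) a :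
  a \in B -> P a -> (forall b, b \in B -> P b -> b = a) ->
  (\sum_(b <- B) `[< P b >] = 1)%N.
Proof.
move=> aB Pa uniq_a; rewrite (big_fsetD1 a) //= asboolT // big_seq big1 // => b.
rewrite !inE => /andP[/eqP ba bB]; apply/eqP; rewrite eqb0; apply/asboolP => Pb.
exact: ba (uniq_a b bB Pb).
Qed.

(** * Local structure of the tiling *)

Section Tiling.
Variables (R : realType) (n : nat) (T : set (set (plane R))) (u U : R).
Hypothesis T_tiling : tiling T.
Hypothesis u_gt0 : 0 < u.
Hypothesis U_gt0 : 0 < U.
Hypothesis inner_disk : forall A, T A -> exists c, disk u c `<=` A.
Hypothesis outer_disk : forall A, T A -> exists c, A `<=` disk U c.
Implicit Types (A B C : set (plane R)) (x y d M : plane R) (r s : R).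

Lemma tile_diameter A x y : T A -> A x -> A y -> edist x y <= 2 * U.
Proof.
move=> /outer_disk[c Ac] /Ac xc /Ac yc.
have := edist_triangle c x y; rewrite (edistC c y).
by move: xc yc; rewrite /disk /=; lra.
Qed.

Lemma tile_eq A B x : T A -> T B -> interior A x -> interior B x -> A = B.
Proof.
move=> TA TB Ax Bx; apply: contrapT => AB.
case: T_tiling => _ _ /(_ A B TA TB AB) /seteqP[h _].
exact: (h x).
Qed.

Lemma exists_tile x : exists2 A, T A & A x.
Proof.
by case: T_tiling => _ cov _; have : setT x by []; rewrite -cov => -[A]; exists A.
Qed.

(** The number of cells, along one axis, of a grid of mesh u / 4 that suffices to
cover a disk of radius r. *)
Definition grid_size r := (2 * (Num.truncn (r / (u / 4))).+2)%N.

(** Each tile is mapped to the cell of the grid that contains the center of its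
inscribed disk.  The lower left corner of that cell is interior to the tile, and
so determines the tile. *)
Lemma card_inside r M : 0 <= r -> (F1 T r M #<= `I_(grid_size r ^ 2))%card.
Proof.
move=> r0; set h := u / 4; have h0 : 0 < h by rewrite divr_gt0.
set K := (Num.truncn (r / h)).+2; rewrite /grid_size -/h -/K; set N := (2 * K)%N.
have /choice[c cP] : forall A, exists c, T A -> disk u c `<=` A.
  move=> A; have [TA|nTA] := pselect (T A); last by exists (0, 0).
  by have [c cA] := inner_disk TA; exists c.
pose ix (t : R) : int := Num.floor (t / h) + K%:Z.
(* Indices are shifted by K so as to become natural numbers. *)
have ixP t : `|t| <= r -> (`|ix t| < N)%N /\ 0 <= ix t.
  move=> tr; have trh : `|t / h| <= r / h.
    by rewrite normrM (gtr0_norm (_ : 0 < h^-1)) ?invr_gt0 // ler_pM2r ?invr_gt0.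
  move: trh; rewrite ler_norml => /andP[lo hi].
  have rK : r / h < K%:R - 1.
    rewrite /K -[X in _ < X - 1]natr1 addrK.
    by have /truncn_itv/andP[] : 0 <= r / h by rewrite divr_ge0 // ltW.
  have /andP[fl fu] := real_floor_itv (num_real (t / h)).
  have ix0 : 0 <= ix t.
    have : - (K%:Z%:~R) < (Num.floor (t / h) + 1)%:~R :> R.
      apply: le_lt_trans fu; apply: le_trans lo.
      rewrite lerN2; apply: ltW; apply: lt_le_trans rK _.
      by rewrite pmulrn gerBl.
    rewrite -rmorphN /= ltr_int /ix; lia.
  split=> //.
  have : ((Num.floor (t / h))%:~R < (K%:Z)%:~R :> R).
    apply: le_lt_trans fl _; apply: le_lt_trans hi _; apply: lt_trans rK _.
    by rewrite -pmulrn ltrBlDr ltrDl.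
  rewrite ltr_int /N /ix; move: ix0; rewrite /ix; lia.
have N0 : (0 < N)%N by [].
have toN (z : int) : exists k : 'I_N, (`|z| < N)%N -> k = `|z|%N :> nat.
  have [h1|h1] := ltnP `|z| N; first by exists (Ordinal h1).
  by exists (Ordinal N0).
have /choice[ord_z ord_zP] := toN.
pose cell A := (ord_z (ix ((c A).1 - M.1)), ord_z (ix ((c A).2 - M.2))).
have cdist A : F1 T r M A -> edist (c A) M <= r.
  by move=> [TA AM]; apply/AM/(cP A TA); rewrite /disk /= edistxx ltW.
have near_grid t : 0 <= t - (Num.floor (t / h))%:~R * h < h.
  have /andP[fl fu] := real_floor_itv (num_real (t / h)).
  move: fl fu; rewrite ler_pdivlMr // ltr_pdivrMr // intrD mulrDl mul1r; lra.
pose grid A : plane R :=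
  (M.1 + (Num.floor (((c A).1 - M.1) / h))%:~R * h,
   M.2 + (Num.floor (((c A).2 - M.2) / h))%:~R * h).
(* The mesh u / 4 leaves room for a max-norm ball of radius u / 4 about the grid
   point inside the disk of radius u. *)
have grid_in A : T A -> interior A (grid A).
  move=> TA; rewrite /interior; apply/nbhs_ballP; exists h => // y.
  rewrite /ball /= /prod_ball /= /ball /= => -[].
  have := near_grid ((c A).1 - M.1); have := near_grid ((c A).2 - M.2).
  set f1 := (_ * h); set f2 := (_ * h) => /andP[a1 a2] /andP[b1 b2].
  rewrite /grid /= -/f1 -/f2 !ltr_norml => /andP[a3 a4] /andP[b3 b4].
  apply: (cP A TA); rewrite /disk /=; apply/ltW/edist_lt => //;
    rewrite ltr_norml; apply/andP; split; rewrite /h in a1 a2 a3 a4 b1 b2 b3 b4 *; lra.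
have cell_inj : {in F1 T r M &, injective (fun A => val (enum_rank (cell A)))}.
  move=> A B /set_mem FA /set_mem FB /val_inj/enum_rank_inj.
  have [TA _] := FA; have [TB _] := FB.
  have dA := cdist A FA; have dB := cdist B FB.
  have [a1 a1'] := ixP _ (le_trans (edist_fst _ _) dA).
  have [a2 a2'] := ixP _ (le_trans (edist_snd _ _) dA).
  have [b1 b1'] := ixP _ (le_trans (edist_fst _ _) dB).
  have [b2 b2'] := ixP _ (le_trans (edist_snd _ _) dB).
  move=> [/(congr1 val) /= e1 /(congr1 val) /= e2].
  move: e1 e2; rewrite !ord_zP // => e1 e2.
  apply: (tile_eq TA TB (grid_in A TA)); suff -> : grid A = grid B by exact: grid_in.
  by rewrite /grid; congr (_ + _ * h, _ + _ * h); congr (_%:~R);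
    move: e1 e2 a1' a2' b1' b2'; rewrite /ix; lia.
rewrite -(card_le_eql (inj_card_eq cell_inj)); apply: subset_card_le.
move=> _ [A _ <-] /=; rewrite (leq_trans (ltn_ord _)) //.
by rewrite card_prod card_ord mulnn.
Qed.



Lemma finite_inside r M : finite_set (F1 T r M).
Proof.
have [r0|r0] := leP 0 r.
  by apply/finite_set_leP; exists (grid_size r ^ 2)%N; exact: card_inside.
suff -> : F1 T r M = set0 by [].
rewrite -subset0 => A [TA AM]; have [c cA] := inner_disk TA.
have : disk r M c by apply/AM/cA; rewrite /disk /= edistxx ltW.
by rewrite /disk /= leNgt (lt_le_trans r0) // edist_ge0.
Qed.

Let U_ge0 : 0 <= U. Proof. exact: ltW. Qed.

Lemma tile_near A x y r : T A -> A y -> edist y x <= r -> F1 T (r + 2 * U) x A.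
Proof.
move=> TA Ay yx; split=> // z Az; rewrite /disk /=.
have := edist_triangle y z x; have := tile_diameter TA Az Ay; lra.
Qed.

Lemma tiles_at_sub x : tiles_at T x `<=` F1 T (2 * U) x.
Proof.
move=> A [TA Ax]; split=> // z Az; exact: tile_diameter TA Az Ax.
Qed.

Lemma finite_tiles_at x : finite_set (tiles_at T x).
Proof. exact: sub_finite_set (@tiles_at_sub x) (finite_inside _ _). Qed.

Hypothesis n_ge3 : (3 <= n)%N.
Variable cor : set (plane R) -> 'I_n -> plane R.
Hypothesis corP : forall A, T A -> corners_of A (cor A).

(** No side of a tile at x is parallel to d; the sides are those of the chosen
corner lists [cor]. *)
Definition generic_at x d :=
  forall A i, T A -> A x -> cross (edge (cor A) i) d != 0.

Lemma generic_opp x d : generic_at x d -> generic_at x (opp d).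
Proof. by move=> g A i TA Ax; rewrite cross_opp oppr_eq0 g. Qed.

Lemma enters_unique A B x d : T A -> T B -> enters d A x -> enters d B x ->
  A = B.
Proof.
move=> TA TB [_ [s s0 hA]] [_ [t t0 hB]].
have st0 : 0 < Num.min s t / 2 by rewrite divr_gt0 // lt_min s0.
have [ls lt] : Num.min s t <= s /\ Num.min s t <= t.
  by rewrite !ge_min !lexx orbT.
by apply: (tile_eq TA TB (hA _ st0 _) (hB _ st0 _)); lra.
Qed.

(** Tiles are closed: the sign of each affine form passes to the limit. *)
Lemma tile_recurrent A x d : T A ->
  (forall e, 0 < e -> exists s, [/\ 0 < s, s < e & A (along x s d)]) -> A x.
Proof.
move=> TA rec; apply/(polygonP n_ge3 (corP TA)) => i; rewrite leNgt.
apply/negP => neg; set c := cross (edge (cor A) i) d.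
have c1 : 0 < 1 + `|c| by rewrite ltr_pwDl.
have [|s [s0 se /(polygonP n_ge3 (corP TA)) /(_ i)]] :=
  rec (- lside (cor A) i x / (1 + `|c|)).
  by rewrite divr_gt0 // oppr_gt0.
rewrite lside_along -/c; move: se; rewrite ltr_pdivlMr //.
have := ler_norm c; move=> *; nra.
Qed.

(** Near x only finitely many tiles meet the half-line from x in direction d.  One
of them meets it arbitrarily close to x, hence contains x, and d is not parallel
to its sides. *)
Lemma exists_entered x d : generic_at x d -> exists2 A, T A & enters d A x.
Proof.
move=> gen; apply: contrapT => none.
have /choice[f fP] : forall A, exists e, 0 < e /\
    (T A -> forall s, 0 < s -> s < e -> ~ A (along x s d)).
  move=> A; apply: contrapT => noe; apply: none.
  have TA : T A by apply: contrapT => nTA; apply: noe; exists 1.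
  have rec e : 0 < e -> exists s, [/\ 0 < s, s < e & A (along x s d)].
    move=> e0; apply: contrapT => nos; apply: noe; exists e; split=> // _ s s0 se As.
    by apply: nos; exists s.
  have Ax := tile_recurrent TA rec.
  exists A => //; have [s [s0 _ As]] := rec 1 ltr01.
  by apply: (enters_of_point n_ge3 (corP TA) _ s0 Ax As) => i; exact: gen.
pose r := edist d (0, 0).
pose S := fset_set (F1 T (r + 2 * U) x).
have [e e0 eP] := positive_lower_bound S (fun A => (fP A).1).
pose s := Num.min (e / 2) 1.
have s0 : 0 < s by rewrite lt_min ltr01 andbT divr_gt0.
have [se s1] : s <= e / 2 /\ s <= 1 by rewrite !ge_min !lexx orbT.
have [A TA As] := exists_tile (along x s d).
have AS : A \in S.
  rewrite in_fset_set; last exact: finite_inside.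
  apply/mem_set/(tile_near TA As); rewrite edist_along; last exact: ltW.
  by rewrite ler_piMl // edist_ge0.
apply: ((fP A).2 TA s s0 _ As).
have := eP A AS; lra.
Qed.

Definition edges (S : {fset set (plane R)}) : seq (plane R) :=
  [seq edge (cor A) i | A <- enum_fset S, i <- enum 'I_n].

Lemma edges_mem (S : {fset set (plane R)}) A i : A \in S ->
  edge (cor A) i \in edges S.
Proof. by move=> AS; apply: allpairs_f => //; rewrite mem_enum. Qed.

Lemma segment_not_extreme A (a b x : plane R) : segment a b `<=` A ->
  segment a b x -> x <> a -> x <> b -> ~ extreme A x.
Proof.
move=> abA [t [t0 t1 defx]] xa xb [_ ext].
have tn0 : 0 < t.
  rewrite lt_neqAle t0 andbT eq_sym; apply/eqP => t00; apply: xa.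
  by rewrite defx t00 subr0 !mul1r !mul0r !addr0 -surjective_pairing.
have tn1 : t < 1.
  rewrite lt_neqAle t1 andbT; apply/eqP => t00; apply: xb.
  by rewrite defx t00 subrr !mul1r !mul0r !add0r -surjective_pairing.
pose s := Num.min t (1 - t).
have s0 : 0 < s by rewrite lt_min tn0 subr_gt0.
have [st s1] : s <= t /\ s <= 1 - t by rewrite !ge_min !lexx orbT.
have seg s' : - t <= s' -> s' <= 1 - t -> A (along x s' (vec a b)).
  move=> h1 h2; apply: abA; exists (t + s'); split; [lra|lra|].
  by rewrite defx /along /=; congr (_, _); ring.
have [e1 e2] : vec a b = (0, 0) by apply: (ext _ s s0); apply: seg; lra.
have b1 : b.1 = a.1 by lra.
have b2 : b.2 = a.2 by lra.
apply: xa; rewrite defx [RHS]surjective_pairing b1 b2.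
by congr (_, _); ring.
Qed.

(** The corner list q need not be [cor A]: edge-to-edge only provides a common
side in some list of corners of each of the two tiles. *)
Definition mid_side A x := exists (q : 'I_n -> plane R) i,
  [/\ corners_of A q, segment (q i) (q (ordS i)) x, x <> q i & x <> q (ordS i)].

Lemma side_extreme_or_mid A (S : set (plane R)) x : is_side n A S ->
  exists (q : 'I_n -> plane R) i, [/\ corners_of A q, S = segment (q i) (q (ordS i)) &
    extreme A x \/ (x <> q i /\ x <> q (ordS i))].
Proof.
move=> [q [Aq [i defS]]]; exists q, i; split=> //.
have [->|xi] := pselect (x = q i); first by left; exact: (extreme_corner n_ge3 Aq).
have [->|xS] := pselect (x = q (ordS i)); last by right.
by left; exact: (extreme_corner n_ge3 Aq).
Qed.

Hypothesis T_e2e : edge_to_edge n T.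

(** Edge-to-edge at a point common to two tiles: an end of the common side is a
corner of both tiles, because a corner is an extreme point and so cannot lie
strictly inside a segment contained in the tile. *)
Lemma extreme_or_mid_side A B x : T A -> T B -> A <> B -> A x -> B x ->
  extreme A x \/ (mid_side A x /\ mid_side B x).
Proof.
move=> TA TB AB Ax Bx; case: (T_e2e TA TB AB) => [AB0|[y [yA _ ABy]]|[S [SA SB ABS]]].
- by exfalso; have : (A `&` B) x by []; rewrite AB0.
- left; have : (A `&` B) x by []; rewrite ABy => ->.
  by case: yA => q [Aq [i ->]]; exact: (extreme_corner n_ge3 Aq).
have Sx : S x by rewrite -ABS.
have SsubB : S `<=` B by rewrite -ABS => z [].
have [q [i [Aq defS [extA|[xi xS]]]]] := side_extreme_or_mid x SA.
  by left.
have [q' [i' [Bq defS' [extB|[xi' xS']]]]] := side_extreme_or_mid x SB.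
  by rewrite defS in SsubB Sx; case: (segment_not_extreme SsubB Sx xi xS extB).
by right; split; [exists q, i|exists q', i']; split=> //; rewrite -?defS -?defS'.
Qed.

Lemma mid_side_enters A x (q : 'I_n -> plane R) i d : corners_of A q ->
  segment (q i) (q (ordS i)) x -> x <> q i -> x <> q (ordS i) ->
  (forall k, cross (edge q k) d != 0) ->
  exists b : bool, enters (if b then d else opp d) A x.
Proof.
move=> Aq sx xi xS gen.
by have [h|h] := enters_side n_ge3 Aq gen sx (introN eqP xi) (introN eqP xS);
  [exists true|exists false].
Qed.

(** If x were not a corner of A, then x would lie strictly inside a side of A and of
two other tiles B and C.  Each of the three fills a half-disk at x, so that by the
pigeonhole principle two of them are entered in the same one of two opposite
directions. *)
Lemma vertex_corner A x : T A -> A x -> vertex T x -> exists i, x = cor A i.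
Proof.
move=> TA Ax /(card_ge3_others A) [B [C [[TB Bx] [TC Cx] BA CA BC]]].
apply: (corner_of_extreme n_ge3 (corP TA)); apply: contrapT => next.
have [//|[midA midB]] := extreme_or_mid_side TA TB (nesym BA) Ax Bx.
have [//|[_ midC]] := extreme_or_mid_side TA TC (nesym CA) Ax Cx.
case: midA midB midC => [qA [i [Aq xA nA nA']]] [qB [j [Bq xB nB nB']]].
case=> [qC [k [Cq xC nC nC']]].
pose es := [seq edge qA i | i <- enum 'I_n] ++ [seq edge qB i | i <- enum 'I_n]
  ++ [seq edge qC i | i <- enum 'I_n].
have [|t _ gen] := @exists_generic_direction R (1, 0) (0, 1) es.
  by rewrite /cross /= mulr1 mul0r subr0 oner_neq0.
set d := along _ t _ in gen.
have [a Aa] : exists b : bool, enters (if b then d else opp d) A x.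
  apply: (mid_side_enters Aq xA) => // l; apply: gen; last exact: (edge_neq0 n_ge3 Aq).
  by rewrite !mem_cat map_f ?mem_enum.
have [b Bb] : exists b : bool, enters (if b then d else opp d) B x.
  apply: (mid_side_enters Bq xB) => // l; apply: gen; last exact: (edge_neq0 n_ge3 Bq).
  by rewrite !mem_cat (map_f (edge qB)) ?mem_enum ?orbT.
have [c Cc] : exists b : bool, enters (if b then d else opp d) C x.
  apply: (mid_side_enters Cq xC) => // l; apply: gen; last exact: (edge_neq0 n_ge3 Cq).
  by rewrite !mem_cat (map_f (edge qC)) ?mem_enum ?orbT.
have [ab|ab] := eqVneq a b.
  by apply: BA; rewrite -ab in Bb; exact: enters_unique TB TA Bb Aa.
have [ac|ac] := eqVneq a c.
  by apply: CA; rewrite -ac in Cc; exact: enters_unique TC TA Cc Aa.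
have bc : b = c by move: ab ac; case: (a); case: (b); case: (c).
by apply: BC; rewrite -bc in Cc; exact: enters_unique TB TC Bb Cc.
Qed.

(** At a corner of A, whose angle is less than pi, there is a generic line avoiding
the interior of A on both sides of the corner.  Its two directions point into
tiles B and C other than A.  These differ: a tile entered in two opposite
directions has x in its interior, which would then meet the interior of A. *)
Lemma corner_vertex A i : T A -> vertex T (cor A i).
Proof.
move=> TA; have Ap := corP TA; set x := cor A i.
have Ax : A x by exact: (corner_in n_ge3 Ap).
set e := edge (cor A) i; set e' := edge (cor A) (ord_pred i).
have ee : 0 < cross e' e by exact: (edge_cross n_ge3 Ap).
have [|t t0 gen] := @exists_generic_direction R e e' (edges (fset_set (tiles_at T x))).
  by rewrite crossC oppr_eq0 gt_eqF.
(* w lies between the side after the corner and the prolonged side before it. *)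
set w := along e t e' in gen.
have genw : generic_at x w.
  move=> B k TB Bx; apply: gen; last exact: (edge_neq0 n_ge3 (corP TB)).
  apply: edges_mem; rewrite in_fset_set; last exact: finite_tiles_at.
  by apply/mem_set.
have ew : cross e w < 0.
  have -> : cross e w = - (t * cross e' e) by rewrite /cross /w /along /=; ring.
  by rewrite oppr_lt0 mulr_gt0.
have e'w : 0 < cross e' w.
  by have -> : cross e' w = cross e' e by rewrite /cross /w /along /=; ring.
have [B TB Bw] := exists_entered genw.
have [C TC Cw] := exists_entered (generic_opp genw).
have AB : A <> B.
  move=> AB; rewrite -AB in Bw.
  have /(enters_sides n_ge3 Ap Bw) : lside (cor A) i x = 0 by exact: lside_l.
  by rewrite leNgt ew.
have nAC : A <> C.
  move=> nAC; rewrite -nAC in Cw.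
  have /(enters_sides n_ge3 Ap Cw) : lside (cor A) (ord_pred i) x = 0.
    exact: lside_pred.
  by rewrite cross_opp leNgt oppr_lt0 e'w.
have [Bx _] := Bw; have [Cx _] := Cw.
suff BC : B <> C by exact: (card_ge3 (a := A) (b := B) (c := C)).
move=> BC; rewrite -BC in Cw.
(* v points along a diagonal of the parallelogram on the two sides, into A. *)
pose v : plane R := (e.1 - e'.1, e.2 - e'.2).
apply: AB; apply: (enters_unique (x := x) (d := v) TA TB).
  apply: (enters_of_sides n_ge3 Ap Ax) => k /(lside_eq0 Ap)[<-|ik].
    have -> : cross (edge (cor A) i) v = cross e' e.
      by rewrite /cross /v /= /e; ring.
    exact: ee.
  have -> : k = ord_pred i by rewrite ik ordSK.
  have -> : cross (edge (cor A) (ord_pred i)) v = cross e' e.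
    by rewrite /cross /v /= /e'; ring.
  exact: ee.
apply: (enters_of_sides n_ge3 (corP TB) Bx) => k k0; exfalso.
have := enters_sides n_ge3 (corP TB) Bw k0.
have := enters_sides n_ge3 (corP TB) Cw k0.
have := genw B k TB Bx; rewrite cross_opp oppr_ge0 => /eqP h h1 h2.
by apply: h; apply/eqP; rewrite eq_le h1 h2.
Qed.

(** * Patches *)

Lemma F1_mono r s M : r <= s -> F1 T r M `<=` F1 T s M.
Proof.
by move=> rs A [TA Ar]; split=> // x /Ar; rewrite /disk /= => /le_trans; apply.
Qed.

Lemma F2_inside r M : F2 T r M `<=` F1 T (r + 2 * U) M.
Proof. by move=> A [TA [y [Ay yr]] _]; apply: (tile_near TA Ay); rewrite yr. Qed.

(** If a surrounded tile reached a point y beyond the radius r + 2U, the ray from y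
away from M would avoid the tiles of F2, which lie within that radius, and would
make the component of y unbounded. *)
Lemma F3_inside r M : 0 <= r -> F3 T r M `<=` F1 T (r + 2 * U) M.
Proof.
move=> r0 A [TA _ surr]; split=> // y Ay; rewrite /disk /= leNgt.
apply/negP => far; set d : plane R := (y.1 - M.1, y.2 - M.2).
have d_y : edist d (0, 0) = edist y M by rewrite /edist /d /= !subr0.
have rU : 0 <= r + 2 * U by rewrite addr_ge0 // mulr_ge0.
have y1 : along M 1 d = y.
  by rewrite [RHS]surjective_pairing /along /d /=; congr (_, _); ring.
have ray_out s : 1 <= s -> (~` \bigcup_(B in F2 T r M) B) (along M s d).
  move=> s1 [B /F2_inside[_ BM] /BM]; rewrite /disk /= leNgt => /negP; apply.
  rewrite edist_along ?(le_trans ler01) // d_y (lt_le_trans far) //.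
  by rewrite ler_peMl // edist_ge0.
have yC := ray_out 1 (lexx _); rewrite y1 in yC.
have ray_comp : (fun s => along M s d) @` [set s | 1 <= s] `<=`
    connected_component (~` \bigcup_(B in F2 T r M) B) y.
  apply: connected_component_max; last exact: ray_connected.
    by exists 1 => //=.
  by move=> _ [t t1 <-]; exact: ray_out.
have d0 : d = (0, 0).
  apply: (ray_unbounded (surr y (conj Ay yC))) => s s1.
  by apply: ray_comp; exists s.
by move: far; rewrite -d_y d0 edistxx ltNge rU.
Qed.

Lemma patch_inside r M : 0 <= r -> patch T r M `<=` F1 T (r + 2 * U) M.
Proof.
move=> r0 A [[|]|].
- by apply: F1_mono; rewrite lerDl mulr_ge0.
- exact: F2_inside.
- exact: F3_inside.
Qed.

Lemma patch_tile r M A : patch T r M A -> T A.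
Proof. by move=> [[[]|[]]|[]]. Qed.

Lemma finite_patch r M : 0 <= r -> finite_set (patch T r M).
Proof. by move=> r0; exact: sub_finite_set (patch_inside r0) (finite_inside _ _). Qed.

Lemma finite_patch_vertices r M : 0 <= r -> finite_set (patch_vertices T r M).
Proof.
move=> r0; apply: (@sub_finite_set _ _
  ((fun Ai => cor Ai.1 Ai.2) @` (patch T r M `*` [set: 'I_n]))).
  move=> x [vx [A PA Ax]].
  have [i ->] := vertex_corner (patch_tile PA) Ax vx.
  by exists (A, i).
apply: finite_image; apply: finite_setX; first exact: finite_patch.
exact: finite_finset.
Qed.

Definition valence x : nat := #|` fset_set (tiles_at T x)|.

Lemma valence_eq x j : has_valence T j x <-> valence x = j.
Proof.
split=> [|<-]; first exact: card_fset_set.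
have [k xk] := (finite_setP _).1 (finite_tiles_at x).
by rewrite /has_valence /valence (card_fset_set xk).
Qed.

(** All tiles at a point x lie in the disk of radius 2U about x. *)
Definition valence_bound := (grid_size (2 * U) ^ 2)%N.

Lemma valence_le x : (valence x <= valence_bound)%N.
Proof.
apply: geq_card_fset_set; apply: card_le_trans (card_inside x _).
  exact/subset_card_le/tiles_at_sub.
by rewrite mulr_ge0.
Qed.

Lemma vertex_valence x : vertex T x -> (3 <= valence x)%N.
Proof. by apply: leq_card_fset_set; exact: finite_tiles_at. Qed.

(** * Double counting over a patch *)

Section Patch.
Variables (r : R) (M : plane R).
Hypothesis r_ge0 : 0 <= r.

Let P := fset_set (patch T r M).
(** Every tile touching a tile of the patch lies in the disk of radius r + 4U, as
the patch lies in that of radius r + 2U and tiles have diameter at most 2U. *)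
Let B := fset_set (F1 T (r + 4 * U) M).
Let V := fset_set (patch_vertices T r M).

Lemma patch_mem A : (A \in P) = `[< patch T r M A >].
Proof. exact/fset_set_mem/finite_patch. Qed.

Lemma nearby_mem A : (A \in B) = `[< F1 T (r + 4 * U) M A >].
Proof. exact/fset_set_mem/finite_inside. Qed.

Lemma vertices_mem x : (x \in V) = `[< patch_vertices T r M x >].
Proof. exact/fset_set_mem/finite_patch_vertices. Qed.

Lemma tile_at_nearby A x : x \in V -> T A -> A x -> A \in B.
Proof.
rewrite vertices_mem nearby_mem => /asboolP[_ [C PC Cx]] TA Ax; apply/asboolP.
have -> : r + 4 * U = r + 2 * U + 2 * U by ring.
by apply: (tile_near TA Ax); have [_] := patch_inside r_ge0 PC; apply.
Qed.

Lemma patch_sub_nearby : (P `<=` B)%fset.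
Proof.
apply/fsubsetP => A; rewrite patch_mem nearby_mem => /asboolP PA; apply/asboolP.
by apply: F1_mono (patch_inside r_ge0 PA); have := U_ge0; lra.
Qed.

Lemma sum_at_corners (e : plane R -> nat) A : T A ->
  (forall x, ~ A x -> e x = 0%N) ->
  (\sum_(x <- V) e x = \sum_(i | cor A i \in V) e (cor A i))%N.
Proof.
move=> TA e0.
transitivity (\sum_(x <- V) \sum_i (if cor A i == x then e x else 0))%N.
  apply: eq_big_seq => x; rewrite vertices_mem => /asboolP[vx _].
  have [Ax|/e0 ->] := pselect (A x); last first.
    by rewrite big1 // => i _; case: ifP.
  have [i ->] := vertex_corner TA Ax vx.
  rewrite (bigD1 i) //= eqxx big1 ?addn0 // => k ki.
  case: eqP => // /(corner_inj n_ge3 (corP TA)) ik.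
  by rewrite ik eqxx in ki.
rewrite exchange_big /= [RHS]big_mkcond /=; apply: eq_bigr => i _.
case: ifP => [iV|iV].
  rewrite (big_fsetD1 (cor A i)) //= eqxx big_seq big1 ?addn0 // => x.
  by rewrite !inE eq_sym => /andP[/negbTE ->].
by rewrite big_seq big1 // => x xV; case: eqP => // ix; rewrite -ix iV in xV.
Qed.

(** Summing tile by tile: the corners of a tile of the patch are all vertices of the
patch, which gives the weight w, while for the other tiles of B only some of them
are. *)
Lemma double_count (e : plane R -> set (plane R) -> nat) (w : nat) :
  (forall x A, ~ A x -> e x A = 0%N) ->
  (forall A, A \in B -> (\sum_i e (cor A i) A = w)%N) ->
  (w * #|` P| <= \sum_(x <- V) \sum_(A <- B) e x A <= w * #|` B|)%N.
Proof.
move=> e0 ew; rewrite exchange_big /=.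
have BT A : A \in B -> T A by rewrite nearby_mem => /asboolP[].
have le_w A : A \in B -> (\sum_(x <- V) e x A <= w)%N.
  move=> AB; rewrite (sum_at_corners (BT A AB)); last by move=> x; exact: e0.
  by rewrite -(ew A AB) [leqLHS]big_mkcond /=; apply: leq_sum => i _; case: ifP.
have eq_w A : A \in P -> (\sum_(x <- V) e x A = w)%N.
  move=> AP; have AB := fsubsetP patch_sub_nearby _ AP; have TA := BT A AB.
  rewrite (sum_at_corners TA); last by move=> x; exact: e0.
  rewrite -(ew A AB); apply: eq_bigl => i; rewrite vertices_mem; apply/asboolP; split.
    exact: corner_vertex.
  exists A; last exact: (corner_in n_ge3 (corP TA)).
  by move: AP; rewrite patch_mem => /asboolP.
rewrite !card_fset_sum1 !big_distrr /= !muln1; apply/andP; split; last first.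
  by rewrite !big_seq; apply: leq_sum => A AB; exact: le_w.
rewrite [leqRHS](big_fsetID _ (mem P)) /=.
apply: leq_trans (leq_addr _ _); rewrite leq_eqVlt; apply/orP; left; apply/eqP.
rewrite (_ : [fset x in B | mem P x]%fset = P).
  by rewrite big_seq [RHS]big_seq; apply: eq_bigr => A AP; rewrite eq_w.
apply/fsetP => A; rewrite !inE /=; apply/andP/idP => [[] //|AP].
by split=> //; exact: (fsubsetP patch_sub_nearby).
Qed.

Lemma valence_sum : forall x, x \in V -> (\sum_(A <- B) `[< A x >] = valence x)%N.
Proof.
move=> x xV; rewrite /valence.
have -> : tiles_at T x = F1 T (r + 4 * U) M `&` [set A | A x].
  apply/seteqP; split=> A [] => [TA Ax|[TA _] Ax]; split=> //.
  by have := tile_at_nearby xV TA Ax; rewrite nearby_mem => /asboolP.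
by rewrite (card_fset_set_sub _ (finite_inside _ _) (erefl _)).
Qed.

Lemma count_corners : (n * #|` P| <= \sum_(x <- V) valence x <= n * #|` B|)%N.
Proof.
rewrite -(eq_big_seq _ valence_sum); apply: double_count => [x A nA|A AB].
  by rewrite asboolF.
have TA : T A by move: AB; rewrite nearby_mem => /asboolP[].
rewrite -[RHS]card_ord -sum1_card; apply: eq_bigr => i _; rewrite asboolT //.
exact: (corner_in n_ge3 (corP TA)).
Qed.

(** For a direction generic with respect to all tiles of B, the incidences where d
or its opposite points inside number 2 at each vertex and n - 2 for each tile. *)
Lemma count_entries : ((n - 2) * #|` P| <= 2 * #|` V| <= (n - 2) * #|` B|)%N.
Proof.
have [|t _ gen] := @exists_generic_direction R (1, 0) (0, 1) (edges B).
  by rewrite /cross /= mulr1 mul0r subr0 oner_neq0.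
set d := along _ t _ in gen.
have BT A : A \in B -> T A by rewrite nearby_mem => /asboolP[].
have genB A i : A \in B -> cross (edge (cor A) i) d != 0.
  move=> AB; apply: gen; first exact: edges_mem.
  exact: (edge_neq0 n_ge3 (corP (BT A AB))).
have one x e : x \in V -> generic_at x e ->
    (\sum_(A <- B) `[< enters e A x >] = 1)%N.
  move=> xV ge; have [A TA Ae] := exists_entered ge.
  apply: (sum_one (tile_at_nearby xV TA Ae.1) Ae) => C CB Ce.
  exact: enters_unique (BT C CB) TA Ce Ae.
have two x : x \in V ->
    (\sum_(A <- B) (`[< enters d A x >] + `[< enters (opp d) A x >]) = 2)%N.
  move=> xV; have ge : generic_at x d.
    by move=> A i TA Ax; apply: genB; exact: tile_at_nearby xV TA Ax.
  by rewrite big_split /= !one //; exact: generic_opp.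
have -> : (2 * #|` V| = \sum_(x <- V) \sum_(A <- B)
    (`[< enters d A x >] + `[< enters (opp d) A x >]))%N.
  by rewrite (eq_big_seq _ two) card_fset_sum1 big_distrr /= muln1.
apply: double_count => [x A nA|A AB].
  by rewrite !asboolF // => -[].
by apply: (enter_count n_ge3 (corP (BT A AB))) => i; exact: genB.
Qed.

Lemma vj_numE j : vj_num T j r M = (\sum_(x <- V) (valence x == j))%N%:R.
Proof.
rewrite /vj_num /count_set; congr (_%:R).
rewrite (_ : [set x | _] = patch_vertices T r M `&` [set x | has_valence T j x]) //.
rewrite (card_fset_set_sub _ (finite_patch_vertices M r_ge0) (erefl _)).
apply: eq_bigr => x _; congr (nat_of_bool _).
by apply/asboolP/eqP => /valence_eq.
Qed.

(** Grouping the vertices by valence; the range is exhausted since valences lie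
between 3 and the bound. *)
Lemma sum_by_valence (f : nat -> nat) k : (valence_bound < k)%N ->
  (\sum_(3 <= j < k) f j * \sum_(x <- V) (valence x == j) =
   \sum_(x <- V) f (valence x))%N.
Proof.
move=> vk; under eq_bigr do rewrite big_distrr /=.
rewrite exchange_big /=; apply: eq_big_seq => x; rewrite vertices_mem.
move=> /asboolP[/vertex_valence v3 _].
have v_in : valence x \in index_iota 3 k.
  by rewrite mem_index_iota v3 (leq_ltn_trans (valence_le x)).
rewrite (bigD1_seq _ v_in) ?iota_uniq //= eqxx muln1 big1 ?addn0 // => j.
by move=> /negbTE; rewrite eq_sym => ->; rewrite muln0.
Qed.

End Patch.

(** * Limits *)

Section Limits.
Variable M : plane R.
Hypothesis vj_cvg : forall j, cvg (vj_num T j r M / t_num T r M @[r --> +oo]).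

Let inside r := #|` fset_set (F1 T r M)|.

Lemma inside_gt0 r : 4 * U <= r -> (0 < inside r)%N.
Proof.
move=> Ur; have [A TA AM] := exists_tile M.
rewrite cardfs_gt0; apply/fset0Pn; exists A.
rewrite fset_set_mem; last exact: finite_inside.
apply/asboolP.
have MM : edist M M <= 0 by rewrite edistxx.
by apply: F1_mono (tile_near TA AM MM); have := U_gt0; lra.
Qed.

Lemma inside_le r : 0 <= r ->
  (inside r)%:R <= ((2 / (u / 4) + 4) * (r + 1)) ^+ 2 :> R.
Proof.
move=> r0; have h0 : 0 < u / 4 by rewrite divr_gt0.
have := geq_card_fset_set (card_inside M r0).
rewrite -/(inside r) -(ler_nat R) natrX => /le_trans; apply.
have tr : (Num.truncn (r / (u / 4)))%:R <= r / (u / 4).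
  by have /truncn_itv/andP[] : 0 <= r / (u / 4) by rewrite divr_ge0 // ltW.
have i0 : 0 < (u / 4)^-1 by rewrite invr_gt0.
rewrite lerXn2r ?nnegrE //.
  by rewrite mulr_ge0 ?addr_ge0 // mulr_ge0 // ltW.
by rewrite /grid_size natrM -addn2 natrD; nra.
Qed.

Lemma inside_le_t r : 0 <= r -> (inside r)%:R <= t_num T r M.
Proof.
move=> r0; rewrite ler_nat; apply: fsubset_leq_card.
rewrite -fset_set_sub; [|exact: finite_inside|exact: finite_patch].
by move=> A ?; left; left.
Qed.

(** The common part of the two limit computations: f is the weight of a vertex as a
function of its valence (the valence itself, or 2), and w the weight of a tile
(n, or n - 2). *)
Lemma weighted_limit (w : R) (f : nat -> nat) k :
  (valence_bound < k)%N -> 0 <= w ->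
  (forall r, 0 <= r ->
     w * t_num T r M <=
       (\sum_(x <- fset_set (patch_vertices T r M)) f (valence x))%N%:R
     <= w * (inside (r + 4 * U))%:R) ->
  \sum_(3 <= j < k) (f j)%:R * vj_lim T M j = w.
Proof.
move=> vk w0 sand.
pose X r := \sum_(3 <= j < k) (f j)%:R * vj_num T j r M.
have XE r : 0 <= r ->
    X r = (\sum_(x <- fset_set (patch_vertices T r M)) f (valence x))%N%:R.
  move=> r0; rewrite -(sum_by_valence M r0 f vk) natr_sum.
  by apply: eq_bigr => j _; rewrite vj_numE // -natrM.
apply: (@limit_of_sandwich _ inside (fun r => t_num T r M) X
  (2 / (u / 4) + 4) (4 * U)) => //.
- by rewrite mulr_gt0.
- exact: inside_gt0.
- exact: inside_le.
- exact: inside_le_t.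
- by move=> r r0; rewrite XE //; exact: sand.
under eq_cvg do rewrite /X mulr_suml.
apply: cvg_big => [|j _]; first exact: add_continuous.
under eq_cvg do rewrite -mulrA.
by apply: cvgMr; exact: vj_cvg.
Qed.

Lemma mean_corners k : (valence_bound < k)%N ->
  \sum_(3 <= j < k) j%:R * vj_lim T M j = n%:R.
Proof.
move=> vk; apply: (@weighted_limit _ id) => // r r0.
by have /andP[lo hi] := count_corners M r0; rewrite -!natrM !ler_nat lo.
Qed.

Lemma mean_vertices k : (valence_bound < k)%N ->
  \sum_(3 <= j < k) vj_lim T M j = (n%:R - 2) / 2.
Proof.
move=> vk; have n2 : (2 <= n)%N by exact: ltnW.
have : \sum_(3 <= j < k) 2 * vj_lim T M j = (n - 2)%:R :> R.
  apply: (@weighted_limit _ (fun=> 2%N)) => // r r0.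
  have -> : (\sum_(x <- fset_set (patch_vertices T r M)) 2 =
      2 * #|` fset_set (patch_vertices T r M)|)%N.
    by rewrite card_fset_sum1 big_distrr.
  by have /andP[lo hi] := count_entries M r0; rewrite -!natrM !ler_nat lo.
by rewrite -mulr_sumr natrB // => <-; rewrite [2 * _]mulrC mulfK ?pnatr_eq0.
Qed.

Lemma v_limE k : (valence_bound < k)%N ->
  v_lim T M = \sum_(3 <= j < k) vj_lim T M j.
Proof.
move=> vk; apply: cvg_lim => //.
have vE r : 0 <= r -> v_num T r M / t_num T r M =
    \sum_(3 <= j < k) vj_num T j r M / t_num T r M.
  move=> r0; rewrite -mulr_suml; congr (_ / _).
  rewrite /v_num /count_set card_fset_sum1 -(sum_by_valence M r0 (fun=> 1%N) vk).
  by rewrite natr_sum; apply: eq_bigr => j _; rewrite mul1n vj_numE.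
apply: (@cvg_trans _ (\sum_(3 <= j < k) vj_num T j r M / t_num T r M @[r --> +oo])).
  apply: near_eq_cvg; exists 0; split=> // r /ltW r0 /=; exact/esym/vE.
by apply: cvg_big => [|j _]; [exact: add_continuous|exact: vj_cvg].
Qed.

Lemma mean_valence k : (valence_bound < k)%N ->
  \sum_(3 <= j < k) j%:R * w_lim T M j = 2 * n%:R / (n%:R - 2).
Proof.
move=> vk; rewrite /w_lim (v_limE vk) (mean_vertices vk).
under eq_bigr do rewrite mulrA.
by rewrite -mulr_suml (mean_corners vk) invf_div mulrCA mulrA.
Qed.

End Limits.
End Tiling.

Theorem proposition3 (R : realType) (n : nat) (T : set (set (plane R)))
    (M : plane R) :
  (3 <= n)%N ->
  strongly_balanced T M ->
  (forall A, T A -> convex_ngon n A) ->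
  edge_to_edge n T ->
  (\sum_(3 <= j < k) j%:R * w_lim T M j) @[k --> \oo]
    --> (2 * n%:R / (n%:R - 2) : R).
Proof.
move=> n_ge3 [[T_tiling _ _ [u [U [u0 U0 size]]]] _ vj_cvg] ngons e2e.
have /choice[cor corP] : forall A, exists p : 'I_n -> plane R, T A -> corners_of A p.
  move=> A; have [/ngons[p Ap]|nTA] := pselect (T A); first by exists p.
  by exists (fun=> (0, 0)).
have inner A (TA : T A) := (size A TA).1; have outer A (TA : T A) := (size A TA).2.
apply: cvg_near_cst; exists (valence_bound u U).+1 => // k /= vk.
exact: (mean_valence T_tiling u0 U0 inner outer n_ge3 corP e2e vj_cvg vk).
Qed.
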